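(* Let $f\colon[0,1]\to[0,\infty]$ be a strictly decreasing continuous function with $f(1)=0$, and let $I\colon[0,1]^2\to[0,1]$ be the $f$-implication $I(x,y)=f^{-1}(x\cdot f(y))$, $x,y\in[0,1]$. Then $I$ does not satisfy the functional equation $I(I(y,x),I(x,y))=I(x,y)$ for all $x,y\in[0,1]$; that is, no $f$-generated implication satisfies this equation.
   Context: In the definition of an $f$-implication the convention $0\cdot\infty=0$ is used. *)

(* Defs.v *)
From HB Require Import structures.
From mathcomp Require Import all_boot all_order all_algebra.
From mathcomp Require Import all_classical all_reals all_analysis.

Set Implicit Arguments.
Unset Strict Implicit.
Unset Printing Implicit Defensive.

Import Order.TTheory GRing.Theory Num.Theory.
Import numFieldNormedType.Exports.

Local Open Scope classical_set_scope.
Local Open Scope ring_scope.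

(* A generator [0,1] -> [0,+oo] is a total function R -> \bar R of which only
   the restriction to [0,1] is constrained; continuity is for the topology of
   the extended real line, so both f 0 = +oo and f 0 finite are allowed. *)
Record f_generator (R : realType) (f : R -> \bar R) : Prop := FGenerator {
  f_generator_ge0 : forall x, x \in `[0, 1] -> (0 <= f x)%E;
  f_generator_decr : forall x y, x \in `[0, 1] -> y \in `[0, 1] ->
    x < y -> (f y < f x)%E;
  f_generator_continuous : {within `[0, 1], continuous f};
  f_generator1 : f 1 = 0%E }.

(* [pinv `[0, 1] f] is the inverse of f restricted to [0,1]; it is only
   meaningful on f([0,1]) = [0, f 0], which contains x * f y for all x, y in
   [0,1]. The product of \bar R satisfies 0 * +oo = 0. *)
Definition f_implication (R : realType) (f : R -> \bar R) (x y : R) : R :=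
  pinv `[0%R : R, 1%R] f (x%:E * f y)%E.

(* Main.v *)
Require Import Defs.
From mathcomp Require Import all_boot all_order all_algebra.
From mathcomp Require Import all_classical all_reals all_analysis.
From mathcomp Require Import lra.

Import Order.TTheory GRing.Theory Num.Theory.
Import numFieldNormedType.Exports.

Local Open Scope classical_set_scope.
Local Open Scope ring_scope.

(** Put [z := I(1/2, 1/2)], so that [f z = f(1/2) / 2] is a positive real. The
    equation at [x = y = 1/2] reads [I(z, z) = z]; applying [f] gives
    [z * f z = f z], hence [z = 1] and [f z = 0], a contradiction. *)

Lemma f_generator_inj (R : realType) (f : R -> \bar R) (hf : f_generator f) :
  {in `[0, 1]%classic &, injective f}.
Proof.
move=> x y; rewrite !inE /= => x01 y01 fxy.
have [xy|yx|//] := ltgtP x y.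
- by have := f_generator_decr hf x01 y01 xy; rewrite fxy ltxx.
- by have := f_generator_decr hf y01 x01 yx; rewrite fxy ltxx.
Qed.

(** Strict monotonicity leaves [0] as the only point of [[0, 1]] where [f] can be infinite: for
    [0 < x] the value [f x] is strictly below [f 0], hence below [+oo]. *)
Lemma f_generator_fin_num (R : realType) (f : R -> \bar R)
    (hf : f_generator f) (x : R) : x \in `]0, 1] -> f x \is a fin_num.
Proof.
rewrite in_itv /= => /andP[x0 x1].
have x01 : x \in `[0, 1] by rewrite in_itv /= (ltW x0) x1.
have o01 : (0 : R) \in `[0, 1] by rewrite in_itv /= lexx ler01.
rewrite ge0_fin_numE; last exact: (f_generator_ge0 hf).
exact: lt_le_trans (f_generator_decr hf o01 x01 x0) (leey _).
Qed.

(** Carries the continuity of [f] over to the real-valued [fine \o f] wherever [f] is finite. *)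
Lemma fine_continuous_fin_num (R : realType) (u : \bar R) :
  u \is a fin_num -> {for u, continuous (@fine R)}.
Proof. by move=> /fineK <-; apply: (@fine_cvg _ _ _ _ idfun); exact: cvg_id. Qed.

(* At [y = 0] the value [f 0] may be infinite, so the real-valued intermediate
   value theorem is applied on [y, 1] with [0 < y]. *)
Lemma f_generator_ivt (R : realType) (f : R -> \bar R) (hf : f_generator f)
    (y : R) (v : \bar R) :
  y \in `]0, 1] -> (0 <= v <= f y)%E -> exists2 z, z \in `[y, 1] & f z = v.
Proof.
move=> y01 /andP[v0 vfy].
have fin z : z \in `[y, 1] -> f z \is a fin_num.
  move=> zy; apply: (f_generator_fin_num R f hf).
  by move: y01 zy; rewrite !in_itv /= => /andP[y0 _] /andP[/(lt_le_trans y0)-> ->].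
have [y0 y1] : 0 < y /\ y <= 1 by move: y01; rewrite in_itv /= => /andP.
have fy : f y \is a fin_num by apply: fin; rewrite in_itv /= lexx.
have fv : v \is a fin_num.
  by rewrite ge0_fin_numE// (le_lt_trans vfy)// ltey_eq fy.
have cf : {within `[y, 1], continuous (@fine R \o f)}.
  apply: within_continuous_comp.
    move=> _ /set_mem[z zy <-].
    exact: (fine_continuous_fin_num R _ (fin z zy)).
  apply: continuous_subspaceW (f_generator_continuous hf) => z /=.
  by rewrite !in_itv /= => /andP[/(le_trans (ltW y0))-> ->].
have f1 : (fine \o f) 1 = 0 by rewrite /= (f_generator1 hf).
have [|z zy fz] := IVT y1 cf (v := fine v).
(* Since [f 1 = 0], the endpoint values span the interval from [0] to [fine (f y)]. *)
- have fy0 : 0 <= fine (f y) by rewrite fine_ge0// (le_trans v0).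
  by rewrite f1 min_r// max_l//= fine_ge0// fine_le.
- by exists z => //; rewrite -(fineK (fin z zy)) -(fineK fv); congr EFin.
Qed.

(** As [0 <= x <= 1], the product lies between [0] and [f y], so [f] attains it on [[y, 1]], and
    injectivity forces [pinv] to return that preimage. The lower bound [y] keeps the result
    positive, so the lemma can be applied to it again. *)
Lemma f_implicationP (R : realType) (f : R -> \bar R) (hf : f_generator f)
    (x y : R) : x \in `[0, 1] -> y \in `]0, 1] ->
  f_implication f x y \in `[y, 1] /\ f (f_implication f x y) = (x%:E * f y)%E.
Proof.
move=> x01 y01.
have [x0 x1] : 0 <= x /\ x <= 1 by move: x01; rewrite in_itv /= => /andP.
have [y0 y1] : 0 < y /\ y <= 1 by move: y01; rewrite in_itv /= => /andP.
have fy0 : (0 <= f y)%E.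
  by apply: (f_generator_ge0 hf); rewrite in_itv /= (ltW y0).
have [|z zy fz] := f_generator_ivt R f hf y (x%:E * f y)%E y01.
  by rewrite mule_ge0 ?lee_fin//= gee_pMl ?lee_fin.
suff -> : f_implication f x y = z by [].
rewrite /f_implication -fz; apply: pinvKV; first exact: f_generator_inj.
rewrite inE /= in_itv /=; move: zy; rewrite in_itv /= => /andP[yz ->].
by rewrite (le_trans (ltW y0) yz).
Qed.

Theorem theorem2p10 (R : realType) (f : R -> \bar R) (hf : f_generator f) :
  let I := f_implication f in
  ~ (forall x y : R, x \in `[0, 1] -> y \in `[0, 1] ->
       I (I y x) (I x y) = I x y).
Proof.
move=> I IE.
have h01 : (2^-1 : R) \in `[0, 1] by rewrite in_itv /=; lra.
have h01' : (2^-1 : R) \in `]0, 1] by rewrite in_itv /=; lra.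
have o01 : (1 : R) \in `[0, 1] by rewrite in_itv /=; lra.
have [zh fz] := f_implicationP R f hf _ _ h01 h01'.
have := IE _ _ h01 h01; rewrite /I; set z := f_implication f _ _ in zh fz *.
(* The bound [1/2 <= z] rules out [z = 0], so [f_implicationP] applies to the pair [(z, z)]. *)
have [z01 z01'] : z \in `[0, 1] /\ z \in `]0, 1].
  by move: zh; rewrite !in_itv /= => /andP[hz z1]; split; lra.
have [_ +] := f_implicationP R f hf _ _ z01 z01'.
move=> /[swap] ->; rewrite fz.
have : (0 < f 2^-1%R)%E.
  by rewrite -(f_generator1 hf); apply: (f_generator_decr hf) => //; lra.
(* Finiteness of [f] at 1/2 turns the equation into [r / 2 = z * (r / 2)] over the reals, where
   [r > 0] cancels. *)
rewrite -(fineK (f_generator_fin_num R f hf _ h01')) lte_fin.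
set r := fine _ => r0 [zr].
have z1 : z = 1 by nra.
move: fz; rewrite z1 (f_generator1 hf).
rewrite -(fineK (f_generator_fin_num R f hf _ h01')) => -[]; rewrite -/r; lra.
Qed.
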